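(* Let $1\le k\le d$ and let $\mathcal{E}=\mathcal{A}^d$ be a subset in $\mathbb{F}_q^d$. If $$|\mathcal{E}|\gg q^{\frac{kd}{k+1-1/d}},$$ then the number of congruence classes of $k$-simplices determined by $\mathcal{E}$ is at least $c\,q^{\binom{k+1}{2}}$ for some positive constant $c$.
   Context: $\mathbb{F}_q$ is the finite field of order $q$, where $q=p^r$ for some prime $p$ and positive integer $r$; $\mathcal{A}$ is a subset of $\mathbb{F}_q$. The notation $X\ll Y$ (equivalently $Y\gg X$) means that there exists a constant $C>0$ such that $X\le CY$, where $X,Y$ are viewed as functions in $q$. $O(d,\mathbb{F}_q)$ denotes the orthogonal group in $\mathbb{F}_q^d$, i.e. the group of linear maps of $\mathbb{F}_q^d$ preserving the standard form $x_1^2+\cdots+x_d^2$. A $k$-simplex in $\mathbb{F}_q^d$ is given by its vertices $(\mathbf{x}_1,\ldots,\mathbf{x}_{k+1})$ in $\mathbb{F}_q^d$. Two $k$-simplices with vertices $(\mathbf{x}_1,\ldots,\mathbf{x}_{k+1})$ and $(\mathbf{y}_1,\ldots,\mathbf{y}_{k+1})$ are in the same congruence class if there exist $\theta\in O(d,\mathbb{F}_q)$ and $\mathbf{z}\in\mathbb{F}_q^d$ with $\mathbf{z}+\theta(\mathbf{x}_i)=\mathbf{y}_i$ for all $i=1,\ldots,k+1$. The number of congruence classes of $k$-simplices determined by $\mathcal{E}$ is the number of congruence classes containing a $k$-simplex all of whose vertices lie in $\mathcal{E}$.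
   Formalization: The formal theorem assumes q is odd; for even q the claim is false, e.g. k = d = 2 and A = F_q with q = 2^r gives only O(q^2) congruence classes of triangles, not c q^3. *)

(* Defs.v *)
From HB Require Import structures.
From mathcomp Require Import all_boot all_order all_algebra.

Set Implicit Arguments.
Unset Strict Implicit.
Unset Printing Implicit Defensive.

Import Order.TTheory GRing.Theory Num.Theory.

Local Open Scope ring_scope.

Definition std_form (F : finFieldType) (d : nat) (x : 'cV[F]_d) : F :=
  \sum_(i < d) x i 0 ^+ 2.

(* O(d, F), as a set of matrices acting on column vectors. *)
Definition orthogonal_group (F : finFieldType) (d : nat) : {set 'M[F]_d} :=
  [set M : 'M[F]_d | (M \in unitmx)
                     & [forall x : 'cV[F]_d, std_form (M *m x) == std_form x]].

(* A k-simplex is the tuple of its k + 1 vertices; neither distinctness nor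
   affine independence of the vertices is required. *)
Definition simplex (F : finFieldType) (d k : nat) : finType :=
  {ffun 'I_k.+1 -> 'cV[F]_d}.

Definition congruent (F : finFieldType) (d k : nat)
    (x y : simplex F d k) : bool :=
  [exists M in orthogonal_group F d, exists z : 'cV[F]_d,
    forall i : 'I_k.+1, z + M *m x i == y i].

Definition congruence_class (F : finFieldType) (d k : nat)
    (x : simplex F d k) : {set simplex F d k} :=
  [set y | congruent x y].

Definition simplices_in (F : finFieldType) (d k : nat) (E : {set 'cV[F]_d}) :
    {set simplex F d k} :=
  [set x : simplex F d k | [forall i, x i \in E]].

Definition determined_classes (F : finFieldType) (d k : nat)
    (E : {set 'cV[F]_d}) : {set {set simplex F d k}} :=
  [set congruence_class x | x in simplices_in k E].

Definition cart_power (F : finFieldType) (d : nat) (A : {set F}) :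
    {set 'cV[F]_d} :=
  [set x : 'cV[F]_d | [forall i, x i 0 \in A]].

(* Main.v *)
Require Import Defs.
From HB Require Import structures.
From mathcomp Require Import all_boot all_order all_algebra.
From mathcomp Require Import all_fingroup all_solvable all_field all_character.
From mathcomp Require Import reals exp.
From mathcomp Require Import ring lra zify.

Set Implicit Arguments.
Unset Strict Implicit.
Unset Printing Implicit Defensive.

Import Order.TTheory GRing.Theory Num.Theory.

Local Open Scope ring_scope.

(** Write q = #|F|, E = A^d, and let G be the group of maps x |-> z + M x with
M orthogonal.  Counting the triples (g, x, y) with x, y in E^(k+1) and g x = y
in two ways gives

  sum_(g in G) |E :&: g^-1 E|^(k+1)
    = sum_(orbits U) |G| / |U| * |U :&: E^(k+1)|^2.

Every orbit has at most 4^k q^(d(k+1) - k(k+1)/2) elements, so by Cauchy-Schwarz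
it suffices to bound the left-hand side by a constant times its expected size
|G| (|E|^2/q^d)^(k+1).  Up to that main term it is at most
4 |E|^(k-1) sum_g (|E :&: g^-1 E| - |E|^2/q^d)^2, and, the orthogonal group being
transitive on the nonzero vectors of given norm, this variance is controlled by
the L^2 deviation of the number of pairs of points of E at a given distance.
On the Fourier side the distance counts become d-th powers of the
one-dimensional sums S(s) = sum_(a, b in A) chi(s (a - b)^2), for which
|S(s)|^2 <= q |A|^2 when s != 0.  Keeping one factor |S(s)|^2 aside and summing
it exactly (it counts the solutions of (a - b)^2 = (a' - b')^2 in A, at most
2 |A|^3) saves a factor q/|A|; this is where the product structure is used. *)

(** * Preliminaries: Cauchy-Schwarz, odd characteristic, indicators *)

(** Cauchy-Schwarz against the constant 1, read off the double sum of [(f i - f j) ^+ 2]. It is used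
    for real values in [algC], hence the partial order and the reality hypothesis. *)
Lemma sqr_sum_le_card (R : numDomainType) (I : finType) (A : {pred I})
    (f : I -> R) :
  (forall i, f i \is Num.real) ->
  (\sum_(i in A) f i) ^+ 2 <= #|A|%:R * \sum_(i in A) f i ^+ 2.
Proof.
move=> fR.
have e : \sum_(i in A) \sum_(j in A) (f i - f j) ^+ 2
   = (#|A|%:R * (\sum_(i in A) f i ^+ 2) - (\sum_(i in A) f i) ^+ 2) *+ 2.
  have E i : \sum_(j in A) (f i - f j) ^+ 2 = #|A|%:R * f i ^+ 2
      - (f i * 2) * (\sum_(j in A) f j) + \sum_(j in A) f j ^+ 2.
    rewrite mulr_natl -sumr_const mulr_sumr -sumrB -big_split /=.
    by apply: eq_bigr => j _; ring.
  rewrite (eq_bigr _ (fun i _ => E i)) big_split sumrB /= -mulr_sumr.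
  by rewrite -!mulr_suml sumr_const -[X in _ + X]mulr_natl; ring.
rewrite -subr_ge0 -(pmulrn_lge0 _ (isT : 0 < 2)%N) -e.
by do 2![apply: sumr_ge0 => ? _]; rewrite real_exprn_even_ge0 ?rpredB.
Qed.

(** If 2 = 0, the additive order of 1 divides both 2 and the odd number [#|F|], so 1 = 0. *)
Lemma two_neq0 (F : finFieldType) : odd #|F| -> (2 : F) != 0.
Proof.
move=> oddF; apply/eqP => two0.
have d2 : (#[1%R : F]%g %| 2)%N.
  by rewrite order_dvdn expgS expg1 FinRing.zmodMgE; apply/eqP.
have dF : (#[1%R : F]%g %| #|F|)%N.
  by rewrite -cardsT order_dvdG ?inE.
have : (#[1%R : F]%g %| gcdn 2 #|F|)%N by rewrite dvdn_gcd d2 dF.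
rewrite (eqP (_ : coprime 2 #|F|)) ?coprime2n // dvdn1 order_eq1.
by rewrite oner_eq0.
Qed.

Lemma sum_indicator (K : nzRingType) (T : finType) (x : T) (f : T -> K) :
  \sum_t (x == t)%:R * f t = f x.
Proof.
rewrite (bigD1 x) //= eqxx mul1r big1 ?addr0 // => t /negPf.
by rewrite eq_sym => ->; rewrite mul0r.
Qed.

Lemma mx_neq0 (K : nmodType) (m n : nat) (X : 'M[K]_(m, n)) :
  X != 0 -> exists i j, X i j != 0.
Proof.
move=> X0; have [/existsP[i /existsP[j]]|] := boolP [exists i, exists j, X i j != 0].
  by exists i, j.
rewrite negb_exists => /forallP h; case/eqP: X0; apply/matrixP => i j.
rewrite [RHS]mxE; apply/eqP; have := h i; rewrite negb_exists => /forallP /(_ j).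
by rewrite negbK.
Qed.

(** * Exponential sums over a finite field *)

(** The additive group is abelian of order at least 2: its irreducible characters are linear, and at
    least one is not principal. *)
Lemma additive_character (F : finFieldType) :
  exists chi : F -> algC, [/\ {morph chi : x y / x + y >-> x * y},
    forall x, `|chi x| = 1 & exists x, chi x != 1].
Proof.
pose G := [set: F]%G.
have abG : abelian G by apply: FinRing.zmod_abelian.
have lin i : 'chi[G]_i \is a linear_char by apply/char_abelianP.
have NG : (1 < Nirr G)%N.
  have := abG; rewrite card_classes_abelian NirrE => /eqP ->.
  rewrite cardsT.
  apply: leq_trans (max_card [set (0 : F); 1]).
  by rewrite cards2 eq_sym oner_eq0.
pose i : Iirr G := Ordinal NG.
have : 'chi_i != 1 by rewrite irr_eq1.
move=> nt; exists 'chi_i; split.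
- by move=> x y; rewrite -FinRing.zmodMgE lin_charM ?lin // inE.
- by move=> x; apply: normC_lin_char; rewrite ?inE.
apply/existsP; apply: contraNT nt; rewrite negb_exists => /forallP h.
apply/eqP/cfunP => x; rewrite cfun1E inE.
by apply/eqP; rewrite -[_ == _]negbK.
Qed.

Section ExponentialSums.

Variables (F : finFieldType) (chi : F -> algC).
Hypotheses (chiD : {morph chi : x y / x + y >-> x * y})
  (norm_chi : forall x, `|chi x| = 1) (chi_nt : exists x, chi x != 1).

Local Notation q := (#|F|%:R : algC).

Lemma chi0 : chi 0 = 1.
Proof.
have n0 : chi 0 != 0 by rewrite -normr_gt0 norm_chi.
by apply: (mulfI n0); rewrite -chiD addr0 mulr1.
Qed.

Lemma chiN x : chi (- x) = (chi x)^*.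
Proof.
have n0 : chi x != 0 by rewrite -normr_gt0 norm_chi.
by apply: (mulfI n0); rewrite -chiD subrr chi0 -normCK norm_chi expr1n.
Qed.

Lemma chi_sum (I : finType) (P : {pred I}) (f : I -> F) :
  chi (\sum_(i in P) f i) = \prod_(i in P) chi (f i).
Proof. exact: (big_morph chi chiD chi0). Qed.

(** For a nonzero, translating x by b / a multiplies the sum by [chi b], and b is chosen with
    [chi b != 1]. *)
Lemma sum_chi a : \sum_x chi (a * x) = if a == 0 then q else 0.
Proof.
have [->|a0] := eqVneq a 0.
  by under eq_bigr do rewrite mul0r chi0; rewrite sumr_const.
have [b /negPf b1] := chi_nt.
set T := LHS.
have : chi b * T = T.
  rewrite mulr_sumr [RHS](reindex_inj (addrI (b / a))) /=.
  by apply: eq_bigr => x _; rewrite mulrDr chiD mulrCA mulfV // mulr1.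
move/eqP; rewrite -subr_eq0 -{2}[T]mul1r -mulrBl mulf_eq0 subr_eq0 b1 /=.
by move/eqP.
Qed.

Lemma parseval (h : F -> algC) :
  \sum_s `|\sum_t h t * chi (s * t)| ^+ 2 = q * \sum_t `|h t| ^+ 2.
Proof.
transitivity (\sum_s \sum_t \sum_u (h t * (h u)^*) * chi ((t - u) * s)).
  apply: eq_bigr => s _; rewrite normCK rmorph_sum mulr_suml /=.
  apply: eq_bigr => t _; rewrite mulr_sumr; apply: eq_bigr => u _.
  by rewrite rmorphM /= -chiN mulrACA -chiD; congr (_ * chi _); ring.
rewrite exchange_big mulr_sumr /=; apply: eq_bigr => t _.
rewrite exchange_big /= (bigD1 t) //= [X in _ + X]big1 ?addr0 => [|u ut].
  by rewrite -mulr_sumr sum_chi subrr eqxx normCK mulrC.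
by rewrite -mulr_sumr sum_chi subr_eq0 eq_sym (negPf ut) mulr0.
Qed.

(** The sum S(s): the Fourier transform of the number of pairs of A with given squared
    difference. *)
Definition dist_sum (A : {set F}) (s : F) : algC :=
  \sum_(a in A) \sum_(b in A) chi (s * (a - b) ^+ 2).

(** With a ranging over F, the difference of (a - b)^2 and (a - c)^2 is affine in a with slope 2(c -
    b), so summing over a leaves only the terms b = c. *)
Lemma norm_dist_sum (A : {set F}) (s : F) : odd #|F| -> s != 0 ->
  `|dist_sum A s| ^+ 2 <= q * #|A|%:R ^+ 2.
Proof.
move=> oddF s0.
have two0 := two_neq0 oddF.
(* Cauchy-Schwarz in the outer variable, which may then range over all of F. *)
have le1 : `|dist_sum A s| ^+ 2
   <= #|A|%:R * \sum_(a in A) `|\sum_(b in A) chi (s * (a - b) ^+ 2)| ^+ 2.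
  apply: le_trans (sqr_sum_le_card A _) => [|a]; last exact: normr_real.
  by rewrite ler_pXn2r ?nnegrE ?sumr_ge0 // ler_norm_sum.
apply: le_trans le1 _.
rewrite [in X in _ <= X]expr2 mulrCA ler_wpM2l ?ler0n //.
apply: (@le_trans _ _ (\sum_a `|\sum_(b in A) chi (s * (a - b) ^+ 2)| ^+ 2)).
  rewrite [leRHS](bigID [in A]) /= lerDl sumr_ge0 // => a _.
  by rewrite exprn_ge0.
rewrite le_eqVlt; apply/orP; left; apply/eqP.
transitivity (\sum_a \sum_(b in A) \sum_(c in A)
   (chi (s * (b ^+ 2 - c ^+ 2)) * chi (2 * s * (c - b) * a))).
  apply: eq_bigr => a _; rewrite normCK rmorph_sum mulr_suml /=.
  apply: eq_bigr => b _; rewrite mulr_sumr; apply: eq_bigr => c _.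
  by rewrite -chiN -!chiD; congr chi; ring.
rewrite exchange_big /= [RHS]mulrC [RHS]mulr_natl -sumr_const; apply: eq_bigr => b bA.
rewrite exchange_big /= (bigD1 b) //= [X in _ + X]big1 ?addr0 => [|c /andP[_ cb]].
  by rewrite -mulr_sumr sum_chi !subrr !mulr0 eqxx chi0 mul1r.
rewrite -mulr_sumr sum_chi !mulf_eq0 subr_eq0 (negPf s0) (negPf two0).
by rewrite (negPf cb) mulr0.
Qed.

End ExponentialSums.

(** * Distance counts of Cartesian powers and their Fourier transforms *)

Lemma sum_cart_power (K : comNzRingType) (F : finFieldType) (d : nat)
    (A : {set F}) (psi : 'I_d -> F -> K) :
  \sum_(x in cart_power d A) \prod_i psi i (x i 0)
  = \prod_i \sum_(a in A) psi i a.
Proof.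
rewrite bigA_distr_big /=.
rewrite (reindex (fun f : {ffun 'I_d -> F} => \col_i f i)) /=; last first.
  exists (fun x : 'cV[F]_d => [ffun i => x i 0]) => f _.
    by apply/ffunP => i; rewrite ffunE mxE.
  by apply/matrixP => i j; rewrite mxE ffunE ord1.
apply: eq_big => [f|f _]; last by apply: eq_bigr => i _; rewrite mxE.
rewrite inE; apply/forallP/ffun_onP => h i; first by have := h i; rewrite mxE.
by rewrite mxE.
Qed.

Lemma card_cart_power (F : finFieldType) (d : nat) (A : {set F}) :
  #|cart_power d A| = (#|A| ^ d)%N.
Proof.
apply/eqP; rewrite -(eqr_nat algC) natrX -sumr_const -sumr_const.
have := sum_cart_power A (fun (_ : 'I_d) _ => 1 : algC).
rewrite [RHS]prodr_const card_ord => <-; apply/eqP; apply: eq_bigr => x _.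
by rewrite prodr_const expr1n.
Qed.

Definition dist_count (F : finFieldType) (d : nat) (E : {set 'cV[F]_d})
    (t : F) : nat :=
  \sum_(x in E) \sum_(y in E) (std_form (x - y) == t).

(** The zero vector is counted when t = 0, so the Fourier transform is exactly a power of a Gauss
    sum. *)
Definition sphere_count (F : finFieldType) (d : nat) (t : F) : nat :=
  \sum_(v : 'cV[F]_d) (std_form v == t).

Section Energy.

Variables (F : finFieldType) (chi : F -> algC).
Hypotheses (chiD : {morph chi : x y / x + y >-> x * y})
  (norm_chi : forall x, `|chi x| = 1) (chi_nt : exists x, chi x != 1).

Local Notation q := (#|F|%:R : algC).

Lemma card_sqrt_le2 (A : {set F}) (a t : F) :
  (\sum_(b in A) ((a - b) ^+ 2 == t) <= 2)%N.
Proof.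
case: (pickP [pred b in A | (a - b) ^+ 2 == t]) => [b0 /andP[_ /eqP e]|h].
  apply: (@leq_trans (\sum_(b in [set b0; 2 * a - b0]) 1)); last first.
    by rewrite sum1_card cards2; case: (_ != _).
  rewrite [leqLHS]big_mkcond [leqRHS]big_mkcond; apply: leq_sum => b _.
  case: (b \in A) => //; rewrite !inE -e.
  case: eqP => // /eqP; rewrite eqf_sqr => /orP[] /eqP h.
    by rewrite (_ : b = b0) ?eqxx //; move/addrI/oppr_inj: h.
  have -> : b = 2 * a - b0 by rewrite -[b](subKr a) h; ring.
    by rewrite eqxx orbT.
by rewrite big1 // => b bA; move: (h b); rewrite /= bA /= => ->.
Qed.

(** By Parseval this is q times the sum of the squares of the counts c(t) of pairs with (a - b)^2 =
    t; each c(t) is at most 2|A|, since a and t leave two choices of b, and they add up to |A|^2. *)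
Lemma sum_norm_dist_sum (A : {set F}) :
  \sum_s `|dist_sum chi A s| ^+ 2 <= 2 * q * #|A|%:R ^+ 3.
Proof.
pose c t := (\sum_(a in A) \sum_(b in A) ((a - b) ^+ 2 == t))%N.
have c_le t : (c t <= 2 * #|A|)%N.
  by rewrite mulnC -sum_nat_const; apply: leq_sum => a _; apply: card_sqrt_le2.
have sum_c : (\sum_t c t = #|A| ^ 2)%N.
  rewrite exchange_big /= expnS expn1 -sum_nat_const; apply: eq_bigr => a _.
  rewrite exchange_big /= -sum1_card; apply: eq_bigr => b _.
  rewrite (bigD1 ((a - b) ^+ 2)) //= eqxx big1 // => t /negPf.
  by rewrite eq_sym => ->.
have E s : dist_sum chi A s = \sum_t (c t)%:R * chi (s * t).
  under [RHS]eq_bigr do rewrite natr_sum mulr_suml.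
  rewrite exchange_big; apply: eq_bigr => a _ /=.
  under [RHS]eq_bigr do rewrite natr_sum mulr_suml.
  rewrite exchange_big; apply: eq_bigr => b _ /=.
  by rewrite sum_indicator.
under eq_bigr do rewrite E.
rewrite (parseval chiD norm_chi chi_nt) -mulrA mulrCA ler_wpM2l ?ler0n //.
apply: (@le_trans _ _ (\sum_t (2 * #|A|)%:R * (c t)%:R)).
  by apply: ler_sum => t _; rewrite normr_nat -natrX -natrM ler_nat leq_mul.
by rewrite -mulr_sumr -natr_sum sum_c -natrX -!natrM ler_nat -mulnA.
Qed.

(** The form is a sum over coordinates, so [chi] makes it a product and the sum over pairs of A^d
    factors. *)
Lemma sum_dist_count (d : nat) (A : {set F}) (s : F) :
  \sum_t (dist_count (cart_power d A) t)%:R * chi (s * t)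
  = dist_sum chi A s ^+ d.
Proof.
under eq_bigr do rewrite natr_sum mulr_suml.
rewrite exchange_big /=.
transitivity (\sum_(x in cart_power d A)
    \prod_i \sum_(b in A) chi (s * (x i 0 - b) ^+ 2)).
  apply: eq_bigr => x _.
  under eq_bigr do rewrite natr_sum mulr_suml.
  rewrite exchange_big /= -sum_cart_power; apply: eq_bigr => y _.
  rewrite sum_indicator mulr_sumr (chi_sum chiD norm_chi).
  by apply: eq_bigr => i _; rewrite !mxE.
rewrite (sum_cart_power A
  (fun (_ : 'I_d) a => \sum_(b in A) chi (s * (a - b) ^+ 2))).
by rewrite prodr_const card_ord.
Qed.

Lemma sum_sphere_count (d : nat) (s : F) :
  \sum_t (sphere_count d t)%:R * chi (s * t)
  = (\sum_a chi (s * a ^+ 2)) ^+ d.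
Proof.
under eq_bigr do rewrite natr_sum mulr_suml.
rewrite exchange_big /=.
have <- : \prod_(i < d) (\sum_(a in [set: F]) chi (s * a ^+ 2))
    = (\sum_a chi (s * a ^+ 2)) ^+ d.
  by rewrite prodr_const card_ord; under eq_bigl do rewrite inE.
rewrite -(sum_cart_power [set: F] (fun _ a => chi (s * a ^+ 2))).
apply: eq_big => [x|x _].
  by apply/esym; rewrite inE; apply/forallP => i; rewrite inE.
by rewrite sum_indicator mulr_sumr (chi_sum chiD norm_chi).
Qed.

(** The case A = F of [norm_dist_sum], where the sum over b is the same Gauss sum for every a. *)
Lemma norm_gauss_sum (s : F) : odd #|F| -> s != 0 ->
  `|\sum_a chi (s * a ^+ 2)| ^+ 2 <= q.
Proof.
move=> oddF s0; set G := \sum_a _.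
have q0 : 0 < q by rewrite ltr0n; apply/card_gt0P; exists 0.
have e : dist_sum chi [set: F] s = q * G.
  rewrite /dist_sum (eq_bigr (fun _ => G)) => [|a _]; last first.
    under eq_bigl do rewrite inE.
    rewrite (reindex_inj (inv_inj (subKr a))) /=.
    by apply: eq_bigr => b _; rewrite subKr.
  by rewrite sumr_const cardsT mulr_natl.
have := norm_dist_sum chiD norm_chi chi_nt [set: F] oddF s0.
rewrite e cardsT normrM exprMn normr_nat [leRHS]mulrC.
by rewrite ler_pM2l // exprn_gt0.
Qed.

(** Parseval applied to the deviation of the distance counts from their expected value. The factor
    q^(d+1) clears the denominator, so that both sides are integers. *)
Lemma dist_count_deviation_algC (d : nat) (A : {set F}) :
  odd #|F| ->
  q * (\sum_t (q ^+ d.+1 * (dist_count (cart_power d.+1 A) t)%:R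
              - #|A|%:R ^+ d.+1 ^+ 2 * (sphere_count d.+1 t)%:R) ^+ 2)
  <= 6 * #|A|%:R * #|A|%:R ^+ d.+1 ^+ 2 * q ^+ d.+1 ^+ 3.
Proof.
move=> oddF; set n := (#|A|%:R : algC).
pose H t := q ^+ d.+1 * (dist_count (cart_power d.+1 A) t)%:R
  - n ^+ d.+1 ^+ 2 * (sphere_count d.+1 t)%:R.
rewrite -/n -[X in q * X](eq_bigr (fun t => H t ^+ 2) (fun _ _ => erefl)).
have Hreal t : H t ^+ 2 = `|H t| ^+ 2.
  by rewrite real_normK // rpredB // !rpredM ?rpredX ?realn.
under eq_bigr do rewrite Hreal.
rewrite -(parseval chiD norm_chi chi_nt).
have HE s : \sum_t H t * chi (s * t) = q ^+ d.+1 * dist_sum chi A s ^+ d.+1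
    - n ^+ d.+1 ^+ 2 * (\sum_a chi (s * a ^+ 2)) ^+ d.+1.
  rewrite -sum_dist_count -sum_sphere_count !mulr_sumr -sumrB.
  by apply: eq_bigr => t _; rewrite /H mulrBl !mulrA.
have n0 : 0 <= n by rewrite ler0n.
have q0 : 0 <= q by rewrite ler0n.
have nq : n <= q by rewrite ler_nat max_card.
have bound s : `|\sum_t H t * chi (s * t)| ^+ 2
   <= 2 * q ^+ d.+1 ^+ 2 * (q * n ^+ 2) ^+ d * `|dist_sum chi A s| ^+ 2
    + 2 * n ^+ d.+1 ^+ 4 * q ^+ d.+1.
  have rhs0 : 0 <= 2 * q ^+ d.+1 ^+ 2 * (q * n ^+ 2) ^+ d * `|dist_sum chi A s| ^+ 2
    + 2 * n ^+ d.+1 ^+ 4 * q ^+ d.+1.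
    by rewrite addr_ge0 // !mulr_ge0 // ?exprn_ge0 // ?mulr_ge0 // exprn_ge0.
  (* At s = 0 both transforms equal q^(d+1) n^(2(d+1)) and cancel. *)
  have [s0|s0] := eqVneq s 0.
    suff -> : \sum_t H t * chi (s * t) = 0 by rewrite normr0 expr0n.
    rewrite HE /dist_sum s0.
    under eq_bigr do under eq_bigr do rewrite mul0r (chi0 chiD norm_chi).
    under [X in _ - _ * X ^+ _]eq_bigr do rewrite mul0r (chi0 chiD norm_chi).
    rewrite !sumr_const -/n -mulrnA natrM -/n -expr2 -!exprM [(2 * _)%N]mulnC.
    by rewrite mulrC subrr.
  have tri (x y : algC) : `|x - y| ^+ 2 <= 2 * `|x| ^+ 2 + 2 * `|y| ^+ 2.
    apply: (@le_trans _ _ ((`|x| + `|y|) ^+ 2)).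
      by rewrite ler_pXn2r ?nnegrE ?addr_ge0 // ler_normB.
    rewrite -subr_ge0 (_ : _ - _ = (`|x| - `|y|) ^+ 2); last by ring.
    by rewrite real_exprn_even_ge0 ?rpredB ?normr_real.
  rewrite HE; set X := dist_sum _ _ _; set Y := \sum_a _.
  apply: le_trans (tri _ _) _; apply: lerD.
    rewrite normrM exprMn normrX (ger0_norm q0) -!mulrA ler_wpM2l //.
    do 2![apply: ler_wpM2l; first by rewrite exprn_ge0].
    (* One factor |S(s)|^2 is kept for the summation over s; the other d are bounded by q n^2. *)
    rewrite normrX exprAC exprSr.
    rewrite ler_wpM2r ?exprn_ge0 // lerXn2r ?nnegrE ?mulr_ge0 ?exprn_ge0 //.
    exact: norm_dist_sum.
  rewrite normrM exprMn -!mulrA ler_wpM2l // ger0_norm ?exprn_ge0 //.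
  rewrite [n ^+ _ ^+ 2]expr2 -!mulrA.
  do 4![apply: ler_wpM2l; first by rewrite exprn_ge0].
  rewrite normrX exprAC.
  rewrite lerXn2r ?nnegrE ?exprn_ge0 //; exact: norm_gauss_sum.
apply: le_trans (ler_sum _ (fun s _ => bound s)) _.
rewrite big_split /= -mulr_sumr sumr_const.
pose P := n ^+ d; pose Q := q ^+ d.
have P0 : 0 <= P by rewrite exprn_ge0.
have Q0 : 0 <= Q by rewrite exprn_ge0.
have PQ : P <= Q by rewrite lerXn2r.
(* 6 = 4 + 2: the part 4 pays for the distance sums, the part 2 for the Gauss sums, where n is at
   most q. *)
have -> : 6 * n * n ^+ d.+1 ^+ 2 * q ^+ d.+1 ^+ 3
   = 2 * q ^+ d.+1 ^+ 2 * (q * n ^+ 2) ^+ d * (2 * q * n ^+ 3)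
   + 2 * (n * P) ^+ 2 * (q * Q) * q * n * (q * Q ^+ 2).
  have -> : (q * n ^+ 2) ^+ d = Q * P ^+ 2 by rewrite exprMn exprAC.
  by rewrite ![_ ^+ d.+1]exprS -/P -/Q; ring.
apply: lerD.
  rewrite ler_wpM2l ?mulr_ge0 ?exprn_ge0 ?mulr_ge0 ?exprn_ge0 //.
  exact: sum_norm_dist_sum.
rewrite -[leLHS]mulr_natr.
have -> : 2 * n ^+ d.+1 ^+ 4 * q ^+ d.+1 * #|F|%:R
   = 2 * (n * P) ^+ 2 * (q * Q) * q * n * (n * P ^+ 2).
  by rewrite ![_ ^+ d.+1]exprS -/P -/Q; ring.
rewrite ler_wpM2l ?mulr_ge0 ?exprn_ge0 ?mulr_ge0 //.
by apply: ler_pM; rewrite ?exprn_ge0 // lerXn2r.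
Qed.

End Energy.

(** Both sides are images of integers, so the inequality passes from [algC] to [int] and from there
    to R. *)
Lemma dist_count_deviation (R : numDomainType) (F : finFieldType) (d : nat)
    (A : {set F}) (q := #|F|%:R : R) (n := #|A|%:R : R) :
  odd #|F| ->
  q * (\sum_t (q ^+ d.+1 * (dist_count (cart_power d.+1 A) t)%:R
              - n ^+ d.+1 ^+ 2 * (sphere_count d.+1 t)%:R) ^+ 2)
  <= 6 * n * n ^+ d.+1 ^+ 2 * q ^+ d.+1 ^+ 3.
Proof.
move=> oddF; rewrite {}/q {}/n.
pose L (S : numDomainType) : S := #|F|%:R *
  (\sum_t (#|F|%:R ^+ d.+1 * (dist_count (cart_power d.+1 A) t)%:R
     - #|A|%:R ^+ d.+1 ^+ 2 * (sphere_count d.+1 t)%:R) ^+ 2).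
pose B (S : numDomainType) : S :=
  6 * #|A|%:R * #|A|%:R ^+ d.+1 ^+ 2 * #|F|%:R ^+ d.+1 ^+ 3.
have LE S : L S = (L int)%:~R.
  rewrite /L rmorphM rmorph_sum /= rmorph_nat; congr (_ * _).
  by apply: eq_bigr => t _; rewrite rmorphXn rmorphB !rmorphM !rmorphXn !rmorph_nat.
have BE S : B S = (B int)%:~R.
  by rewrite /B !rmorphM !rmorphXn !rmorph_nat.
have [chi [chiD norm_chi chi_nt]] := additive_character F.
have := dist_count_deviation_algC chiD norm_chi chi_nt d A oddF.
change (L algC <= B algC -> L R <= B R).
by rewrite LE BE ler_int [L R]LE [B R]BE ler_int.
Qed.

(** * Quadrics and the orthogonal group *)

Lemma card_quadratic_roots (F : finFieldType) (c a b : F) : c != 0 ->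
  (#|[set r : F | ((c + r * a) + r ^+ 2 * b == 0)%R]| <= 2)%N.
Proof.
move=> c0; set S := [set _ | _].
pose p : {poly F} := c%:P + a *: 'X + b *: 'X^2.
have pE r : p.[r] = (c + r * a) + r ^+ 2 * b.
  by rewrite !hornerD !hornerZ hornerXn hornerX hornerC; ring.
have p0 : p != 0.
  apply: contraNneq c0 => p0; have := pE 0.
  by rewrite p0 horner0 expr0n !mul0r !addr0 => <-.
have szp : (size p <= 3)%N.
  rewrite (leq_trans (size_polyD _ _)) // geq_max.
  rewrite (leq_trans (size_polyD _ _)) ?geq_max ?size_polyC.
    by rewrite (leq_trans (size_scale_leq _ _)) ?size_polyXn.
  rewrite (leq_trans (size_scale_leq _ _)) ?size_polyX // andbT.
  by case: (_ != _).
rewrite cardE -ltnS; apply: leq_trans szp; apply: max_poly_roots => //.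
  by apply/allP => r; rewrite mem_enum inE -pE.
exact: enum_uniq.
Qed.

(** A Schwartz-Zippel bound. Only the restriction of [phi] to lines is constrained, so it serves for
    linear forms, for [std_form] and for quadrics in a subspace. *)
Lemma card_quadric (F : finFieldType) (m n : nat) (W : {set 'M[F]_(m, n)})
    (phi : 'M[F]_(m, n) -> F) (w0 : 'M[F]_(m, n)) :
  (forall w u, exists a b, forall s,
     phi (w + s *: u) = (phi w + s * a) + s ^+ 2 * b) ->
  {in W &, forall x y s, s *: (x - y) \in W} ->
  w0 \in W -> phi w0 != 0 ->
  (#|[set w in W | phi w == 0%R]| * #|F| <= 4 * #|W|)%N.
Proof.
move=> quad lin w0W phi0; set Z := [set _ in _ | _].
have q1 : (1 < #|F|)%N.
  by apply: leq_trans (max_card [set (0 : F); 1]); rewrite cards2 eq_sym oner_eq0.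
(* On each line through w0, phi is a nonzero polynomial of degree at most 2;
   (z, s) |-> s (z - w0) thus covers each direction at most twice. *)
pose D := setX Z [set~ (0 : F)].
have fib u : (#|[set p in D | p.2 *: (p.1 - w0) == u]| <= 2)%N.
  have [a [b ab]] := quad w0 u.
  (* In the fibre over u, z = w0 + s^-1 u, so s^-1 is a root of [phi] along the direction u and
     determines the pair. *)
  apply: leq_trans (card_quadratic_roots a b phi0).
  rewrite -(card_in_imset (f := fun p => p.2^-1)); last first.
    move=> [z s] [z' s']; rewrite !inE /= -!andbA.
    move=> /and4P[_ _ s0 /eqP e] /and4P[_ _ s0' /eqP e'] /invr_inj es.
    rewrite -e -es in e'.
    by rewrite es -(subrK w0 z') (scalerI s0 e') subrK.
  apply: subset_leq_card; apply/subsetP => r /imsetP[[z s]].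
  rewrite !inE /= -!andbA => /and4P[_ z0 s0 /eqP e] ->.
  by rewrite -ab -e scalerA mulVf // scale1r addrC subrK.
have cD : (#|D| <= 2 * #|W|)%N.
  rewrite -sum1_card (partition_big (fun p => p.2 *: (p.1 - w0)) [in W]) /=.
    rewrite mulnC -sum_nat_const; apply: leq_sum => u _.
    by rewrite sum1_card; apply: leq_trans (fib u); rewrite cardsE.
  by move=> [z s]; rewrite !inE /= => /andP[/andP[zW _] _]; apply: lin.
(* |Z| (q - 1) is at most 2|W|, and q is at most 2(q - 1). *)
move: cD; rewrite cardsX cardsC1.
by move: #|Z| #|W| #|F| q1 => z w f q1 cD; nia.
Qed.

Section OrthogonalGroup.

Variables (F : finFieldType) (d : nat).
Hypothesis oddF : odd #|F|.

Local Notation V := 'cV[F]_d.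
Local Notation O := (orthogonal_group F d).

Definition dot (x y : V) : F := (x^T *m y) 0 0.

Lemma std_formE (x : V) : std_form x = dot x x.
Proof. by rewrite /dot mxE; apply: eq_bigr => i _; rewrite mxE. Qed.

Lemma dotC x y : dot x y = dot y x.
Proof. by rewrite /dot -[in RHS](trmxK x) -trmx_mul [RHS]mxE. Qed.

Lemma dotDl x y z : dot (x + y) z = dot x z + dot y z.
Proof. by rewrite /dot linearD mulmxDl mxE. Qed.

Lemma dotZl s x y : dot (s *: x) y = s * dot x y.
Proof. by rewrite /dot linearZ -scalemxAl mxE. Qed.

Lemma dotDr x y z : dot z (x + y) = dot z x + dot z y.
Proof. by rewrite !(dotC z) dotDl. Qed.

Lemma dotZr s x y : dot x (s *: y) = s * dot x y.
Proof. by rewrite !(dotC x) dotZl. Qed.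

Lemma dotBr x y z : dot z (x - y) = dot z x - dot z y.
Proof. by rewrite dotDr -scaleN1r dotZr mulN1r. Qed.

Lemma dotBl x y z : dot (x - y) z = dot x z - dot y z.
Proof. by rewrite !(dotC _ z) dotBr. Qed.

Lemma dot_delta (x : V) i : dot (delta_mx i 0) x = x i 0.
Proof. by rewrite /dot trmx_delta -rowE mxE. Qed.

Lemma std_formN (x : V) : std_form (- x) = std_form x.
Proof. by apply: eq_bigr => i _; rewrite mxE sqrrN. Qed.

Lemma polarization (x y : V) :
  dot x y * 2 = std_form (x + y) - std_form x - std_form y.
Proof. by rewrite !std_formE dotDl !dotDr (dotC y x); ring. Qed.

Lemma form_preserving_mul (M : 'M[F]_d) :
  (forall x : V, std_form (M *m x) = std_form x) -> M^T *m M = 1%:M.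
Proof.
move=> h; have dotM x y : dot (M *m x) (M *m y) = dot x y.
  by apply: (mulIf (two_neq0 oddF)); rewrite !polarization -mulmxDr !h.
apply/matrixP => i j; have := dotM (delta_mx i 0) (delta_mx j 0).
rewrite [RHS]dot_delta /dot trmx_mul -mulmxA (mulmxA M^T) trmx_delta.
by rewrite -rowE -colE !mxE => ->; rewrite eqxx andbT.
Qed.

Lemma orthogonal_groupP M : reflect (M^T *m M = 1%:M) (M \in O).
Proof.
apply: (iffP idP) => [|MM].
  rewrite inE => /andP[_ /forallP h].
  by apply: form_preserving_mul => x; apply/eqP.
rewrite inE; apply/andP; split; first by case: (mulmx1_unit MM).
apply/forallP => x.
by rewrite !std_formE /dot trmx_mul -mulmxA (mulmxA M^T) MM mul1mx.
Qed.

Lemma orthogonal1 : 1%:M \in O.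
Proof. by apply/orthogonal_groupP; rewrite trmx1 mulmx1. Qed.

Lemma orthogonalM M N : M \in O -> N \in O -> M *m N \in O.
Proof.
move=> /orthogonal_groupP MM /orthogonal_groupP NN; apply/orthogonal_groupP.
by rewrite trmx_mul -mulmxA (mulmxA M^T) MM mul1mx.
Qed.

Lemma orthogonal_tr M : M \in O -> M^T \in O.
Proof.
move=> /orthogonal_groupP MM; apply/orthogonal_groupP.
by rewrite trmxK; apply: mulmx1C.
Qed.

Lemma orthogonalN M : M \in O -> - M \in O.
Proof.
move=> /orthogonal_groupP MM; apply/orthogonal_groupP.
by rewrite mulmxN [(- M)^T]linearN mulNmx opprK.
Qed.

Lemma orthogonal_form M x : M \in O -> std_form (M *m x) = std_form x.
Proof. by rewrite inE => /andP[_ /forallP h]; rewrite (eqP (h x)). Qed.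

Lemma orthogonal_inj m M : M \in O ->
  injective (mulmx M : 'M[F]_(d, m) -> 'M[F]_(d, m)).
Proof.
move=> /orthogonal_groupP MM x y e.
by rewrite -[x]mul1mx -MM -mulmxA e mulmxA MM mul1mx.
Qed.

(** Reflection in the hyperplane orthogonal to u. For isotropic u the quotient is 0 by convention
    and the matrix is the identity. *)
Definition reflection (u : V) : 'M[F]_d :=
  1%:M - (2 / std_form u) *: (u *m u^T).

Lemma reflectionE u x :
  reflection u *m x = x - (2 * dot u x / std_form u) *: u.
Proof.
rewrite mulmxBl mul1mx -scalemxAl -mulmxA [u^T *m x]mx11_scalar -/(dot u x).
by rewrite mul_mx_scalar scalerA mulrAC.
Qed.

Lemma reflection_orthogonal u : std_form u != 0 -> reflection u \in O.
Proof.
move=> u0; apply/orthogonal_groupP/form_preserving_mul => x.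
rewrite reflectionE std_formE !dotBl !dotBr !dotZl !dotZr (dotC x u) -!std_formE.
by field.
Qed.

Lemma reflection_diff v w : std_form v = std_form w -> std_form (v - w) != 0 ->
  reflection (v - w) *m v = w.
Proof.
move=> evw h; rewrite reflectionE.
have -> : 2 * dot (v - w) v = std_form (v - w).
  by rewrite std_formE !dotBl !dotBr (dotC w v) -!std_formE -evw; ring.
by rewrite divff // scale1r subKr.
Qed.

Lemma exists_nonorthogonal v w : v != 0 -> w != 0 ->
  exists u, dot u v != 0 /\ dot u w != 0.
Proof.
move=> /mx_neq0[i [i' vi]] /mx_neq0[j [j' wj]].
rewrite !ord1 in vi wj.
have [wi|wi] := eqVneq (w i 0) 0; last by exists (delta_mx i 0); rewrite !dot_delta.
have [vj|vj] := eqVneq (v j 0) 0; last by exists (delta_mx j 0); rewrite !dot_delta.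
exists (delta_mx i 0 + delta_mx j 0).
by rewrite !dotDl !dot_delta wi vj addr0 add0r.
Qed.

(** Witt's theorem for one vector. If v - w is nonisotropic, reflect in it; if v + w is, reflect v
    to -w and change sign; otherwise compose two reflections. *)
Lemma orthogonal_transitive v w : v != 0 -> w != 0 ->
  std_form v = std_form w -> exists2 M, M \in O & M *m v = w.
Proof.
have diff x y : std_form x = std_form y -> std_form (x - y) != 0 ->
    exists2 M, M \in O & M *m x = y.
  move=> exy xy0; exists (reflection (x - y)).
    exact: reflection_orthogonal.
  exact: reflection_diff.
move=> v0 w0 evw; have two0 := two_neq0 oddF.
have [e|] := eqVneq (std_form (v - w)) 0; last exact: diff.
have [e'|h] := eqVneq (std_form (v + w)) 0; last first.
  have [||M MO Mv] := diff v (- w); [by rewrite std_formN|by rewrite opprK|].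
  by exists (- M); rewrite ?orthogonalN // mulNmx Mv opprK.
(* The norms of v - w and v + w add up to four times that of v. *)
have Q0 : std_form v = 0.
  apply: (mulfI two0); apply: (mulfI two0); rewrite !mulr0 -(addr0 0) -{1}e -e'.
  rewrite !std_formE dotBl dotDl !dotBr !dotDr -!std_formE -evw (dotC w v); ring.
have vw0 : dot v w = 0.
  by apply: (mulIf two0); rewrite polarization e' -evw Q0 !subr0 mul0r.
have [u [uv uw]] := exists_nonorthogonal v0 w0.
(* Both v - w and v + w are isotropic, so no reflection sends v to w or -w:
   go through an isotropic z orthogonal to neither v nor w. *)
have [z [zQ vz zw]] :
    exists z, [/\ std_form z = 0, dot v z = dot u v & dot z w = dot u w].
  (* As v is isotropic, the norm of u - s v is affine in s; this s is its root. Subtracting a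
     multiple of v keeps the products with v and w, both orthogonal to v. *)
  exists (u - (std_form u / (2 * dot u v)) *: v); split.
  - rewrite std_formE !dotBl !dotBr !dotZl !dotZr (dotC v u) -!std_formE Q0.
    by field; rewrite uv two0.
  - by rewrite dotC dotBl dotZl -std_formE Q0 mulr0 subr0.
  - by rewrite dotBl dotZl vw0 mulr0 subr0.
have vz0 : std_form (v - z) != 0.
  have -> : std_form (v - z) = - (dot u v * 2).
    by rewrite std_formE !dotBl !dotBr (dotC z v) -!std_formE Q0 zQ vz; ring.
  by rewrite oppr_eq0 mulf_neq0.
have zw0 : std_form (z - w) != 0.
  have -> : std_form (z - w) = - (dot u w * 2).
    by rewrite std_formE !dotBl !dotBr (dotC w z) -!std_formE -evw Q0 zQ zw; ring.
  by rewrite oppr_eq0 mulf_neq0.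
have [|M MO Mv] := diff v z _ vz0; first by rewrite Q0.
have [|N NO Nz] := diff z w _ zw0; first by rewrite zQ -evw.
by exists (N *m M); rewrite ?orthogonalM // -mulmxA Mv.
Qed.

(** Zero is left out, being fixed by O: what remains is empty or a single orbit. *)
Definition sphere (t : F) : {set V} := [set w | (w != 0) && (std_form w == t)].

Lemma card_cV : #|V| = (#|F| ^ d)%N.
Proof. by rewrite card_mx muln1. Qed.

(* The reflections of v in nonisotropic u not orthogonal to v produce enough
   points; the factor 16 ^ d only serves to absorb the case #|F| < 16. *)
Lemma card_sphere_ge (v : V) : v != 0 ->
  (#|F| ^ d <= 16 ^ d * #|F| * #|sphere (std_form v)|)%N.
Proof.
move=> v0; set S := sphere _.
have S1 : (0 < #|S|)%N by apply/card_gt0P; exists v; rewrite inE v0 eqxx.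
have F1 : (0 < #|F|)%N by apply/card_gt0P; exists 0.
have d0 : (0 < d)%N.
  by case: d v v0 {S S1} => // v /eqP[]; apply/matrixP => -[].
have [q16|q16] := ltnP #|F| 16.
  apply: (@leq_trans (16 ^ d)); first by rewrite leq_exp2r // ltnW.
  by rewrite -mulnA leq_pmulr // muln_gt0 F1.
pose U := [set u : V | (std_form u != 0) && (dot u v != 0)].
have [u [uv _]] := exists_nonorthogonal v0 v0.
have cQ : (#|[set w in [set: V] | std_form w == 0%R]| * #|F| <= 4 * #|[set: V]|)%N.
  have [i _] := mx_neq0 v0.
  apply: (@card_quadric _ _ _ _ _ (delta_mx i 0)) => [w x|w x _ _ s||]; rewrite ?inE //.
    exists (2 * dot w x), (std_form x) => s.
    by rewrite !std_formE !dotDl !dotDr !dotZl !dotZr (dotC x w); ring.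
  by rewrite std_formE dot_delta mxE !eqxx oner_eq0.
have cD : (#|[set w in [set: V] | dot w v == 0%R]| * #|F| <= 4 * #|[set: V]|)%N.
  apply: (@card_quadric _ _ _ _ _ u) => [w x|w x _ _ s||]; rewrite ?inE //.
  exists (dot x v), 0 => s.
  by rewrite dotDl dotZl mulr0 addr0.
have cov : (#|[set: V]| <= #|U| + (#|[set w in [set: V] | std_form w == 0%R]|
      + #|[set w in [set: V] | dot w v == 0%R]|))%N.
  apply: leq_trans (leq_add (leqnn _) (leq_card_setU _ _)).
  apply: leq_trans (leq_card_setU _ _); apply: subset_leq_card.
  by apply/subsetP => w _; rewrite !inE; do 2!case: eqP.
(* If the reflection in u sends v to w, then u is a multiple of v - w: at most q vectors u give the
   same w. *)
have cU : (#|U| <= #|S| * #|F|)%N.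
  rewrite -sum1_card (partition_big (fun u => reflection u *m v) [in S]) /=.
    rewrite -sum_nat_const; apply: leq_sum => w _; rewrite sum1_card.
    apply: (@leq_trans #|[set s *: (v - w) | s in F]|); last first.
      exact: leq_imset_card.
    apply: subset_leq_card; apply/subsetP => x; rewrite unfold_in inE => /andP[].
    move=> /andP[Qx xv] /eqP <-; apply/imsetP.
    exists (2 * dot x v / std_form x)^-1 => //.
    rewrite reflectionE subKr scalerA mulVf ?scale1r //.
    by rewrite !mulf_neq0 ?invr_eq0 // two_neq0.
  move=> x; rewrite !inE => /andP[Qx _].
  have RO := reflection_orthogonal Qx.
  rewrite orthogonal_form // eqxx andbT; apply: contraNneq v0 => e.
  by apply/eqP/(orthogonal_inj RO); rewrite mulmx0.
move: cQ cD cov cU; rewrite cardsT card_cV => cQ cD cov cU.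
have : (2 <= 16 ^ d)%N by rewrite (leq_trans _ (leq_pexp2l _ d0)).
move: (16 ^ d)%N (#|F| ^ d)%N cQ cD cov cU F1 S1 q16.
move: #|F| #|S| #|U| #|[set w in [set: V] | std_form w == 0%R]|.
move: #|[set w in [set: V] | dot w v == 0%R]| => a q s w b e f h1 h2 h3 h4 h5 h6 h7 h8.
(* The two excluded quadrics contain at most 8|V|/q vectors, half of V at most when q is at least
   16. *)
have : (f * q <= 2 * (w * q))%N by nia.
rewrite mulnA leq_pmul2r // => h9.
by apply: (leq_trans h9); nia.
Qed.

(** * Averages over the orthogonal group *)

Section Averages.

Variables (R : realFieldType) (h : V -> R).

Let Hs (t : F) : R := \sum_(v in sphere t) h v.

(** As M varies, M v is equidistributed on the sphere of v: by transitivity the sum over M is the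
    same for every w there, and each M permutes the sphere. *)
Lemma sum_orthogonal (v : V) : v != 0 ->
  #|sphere (std_form v)|%:R * (\sum_(M in O) h (M *m v))
  = #|O|%:R * Hs (std_form v).
Proof.
move=> v0; rewrite !mulr_natl -!sumr_const.
transitivity (\sum_(w in sphere (std_form v)) \sum_(M in O) h (M *m w)).
  apply: eq_bigr => w; rewrite inE => /andP[w0 /eqP evw].
  have [N NO Nv] := orthogonal_transitive w0 v0 evw.
  have /orthogonal_groupP NN := NO.
  have mulN_inj : injective (fun M : 'M[F]_d => M *m N).
    by move=> M M' /(congr1 (mulmx^~ N^T)); rewrite /= -!mulmxA (mulmx1C NN) !mulmx1.
  rewrite -Nv [RHS](reindex_inj mulN_inj) /=; apply: eq_big => [M|M _].
    apply/idP/idP => [MO|MNO]; first exact: orthogonalM.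
    by have := orthogonalM MNO (orthogonal_tr NO); rewrite -mulmxA (mulmx1C NN) mulmx1.
  by rewrite mulmxA.
rewrite exchange_big /=; apply: eq_bigr => M MO.
rewrite /Hs [RHS](reindex_inj (orthogonal_inj MO)) /=.
apply: eq_bigl => w; rewrite !inE orthogonal_form //.
by rewrite -{2}(mulmx0 _ M) (inj_eq (orthogonal_inj MO)).
Qed.

(** By equidistribution the nonzero vectors of norm t contribute |O| Hs(t)^2 divided by the size of
    the sphere, and 1/K bounds that size from below. *)
Lemma orthogonal_average_le (K : R) : 0 <= K ->
  (forall v : V, v != 0 -> 1 <= K * #|sphere (std_form v)|%:R) ->
  \sum_(M in O) \sum_v h v * h (M *m v)
  <= #|O|%:R * ((1 + 2 * K) * h 0 ^+ 2
     + 2 * K * \sum_t (\sum_(v | std_form v == t) h v) ^+ 2).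
Proof.
move=> K0 hK.
have O0 : 0 <= #|O|%:R :> R by rewrite ler0n.
rewrite exchange_big (bigD1 0) //=.
under eq_bigr do rewrite mulmx0.
rewrite sumr_const -expr2 -[X in X + _]mulr_natl.
have -> : \sum_(v | v != 0) \sum_(M in O) h v * h (M *m v)
   = \sum_t #|O|%:R * (Hs t ^+ 2 / #|sphere t|%:R).
  transitivity (\sum_(v | v != 0)
      h v * (#|O|%:R * Hs (std_form v) / #|sphere (std_form v)|%:R)).
    apply: eq_bigr => v v0; rewrite -mulr_sumr -sum_orthogonal // mulrAC divff ?mul1r //.
    by rewrite pnatr_eq0 -lt0n; apply/card_gt0P; exists v; rewrite inE v0 eqxx.
  rewrite (partition_big (@std_form F d) predT) //=; apply: eq_bigr => t _.
  have -> : #|O|%:R * (Hs t ^+ 2 / #|sphere t|%:R)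
      = Hs t * (#|O|%:R * Hs t / #|sphere t|%:R) by rewrite expr2; ring.
  rewrite [in RHS]/Hs mulr_suml.
  apply: eq_big => [v|v]; first by rewrite inE.
  by move=> /andP[_ /eqP ->].
have bnd t : Hs t ^+ 2 / #|sphere t|%:R <= K * Hs t ^+ 2.
  have [S0|[v]] := set_0Vmem (sphere t).
    by rewrite /Hs S0 big_set0 expr0n mul0r mulr0.
  rewrite inE => /andP[v0 /eqP <-].
  have S0 : 0 < #|sphere (std_form v)|%:R :> R.
    by rewrite ltr0n; apply/card_gt0P; exists v; rewrite inE v0 eqxx.
  rewrite ler_pdivrMr // mulrAC ler_peMl ?sqr_ge0 //; exact: hK.
(* Restoring the zero vector changes only the sum for its own norm; (x - y)^2 is at most 2x^2 +
   2y^2. *)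
have Hs_le t : Hs t ^+ 2 <= 2 * (\sum_(v | std_form v == t) h v) ^+ 2
    + 2 * ((std_form (0 : V) == t)%:R * h 0 ^+ 2).
  have -> : Hs t = \sum_(v | std_form v == t) h v - (std_form (0 : V) == t)%:R * h 0.
    rewrite /Hs; have [e|ne] := eqVneq (std_form (0 : V)) t.
      rewrite [X in _ = X - _](bigD1 0) ?e //= mul1r addrAC subrr add0r.
      by apply: eq_bigl => v; rewrite inE andbC.
    rewrite mul0r subr0; apply: eq_bigl => v; rewrite inE.
    by have [->|//] := eqVneq v 0; rewrite (negPf ne).
  set x := \sum_(v | _) _; set b := (_ == _).
  have -> : b%:R * h 0 ^+ 2 = (b%:R * h 0) ^+ 2.
    by case: b; rewrite ?mulr1n ?mulr0n ?mul1r ?mul0r ?expr0n.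
  have := sqr_ge0 (x + b%:R * h 0); nra.
rewrite -mulr_sumr -mulrDr ler_wpM2l // mulrDl mul1r -addrA lerD2l.
apply: le_trans (ler_sum _ (fun t _ => bnd t)) _.
rewrite -mulr_sumr.
apply: le_trans (ler_wpM2l K0 (ler_sum _ (fun t _ => Hs_le t))) _.
rewrite big_split /= -!mulr_sumr sum_indicator.
by rewrite mulrDr addrC !mulrA [K * 2]mulrC.
Qed.

End Averages.

(** * Moments of the number of points of E moved into E *)

(** The number |E :&: g^-1 E| for g = (z, M): points moved into E, not fixed points. *)
Definition fixed_count (E : {set V}) (M : 'M[F]_d) (z : V) : nat :=
  #|[set x in E | z + M *m x \in E]|.

Section Variance.

Variables (R : realFieldType) (E : {set V}).

Local Notation e := (#|E|%:R : R).

Definition diff_count (v : V) : R :=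
  \sum_(x in E) \sum_(y in E) (x - y == v)%:R.

(** The common mean of [fixed_count E M] over z and of [diff_count] over v. *)
Let mu : R := e ^+ 2 / #|V|%:R.

Lemma fixed_countE (M : 'M[F]_d) z :
  (fixed_count E M z)%:R
  = \sum_(x in E) \sum_(y in E) (y - M *m x == z)%:R :> R.
Proof.
rewrite /fixed_count -sum1_card natr_sum big_mkcond [RHS]big_mkcond /=.
apply: eq_bigr => x _; rewrite inE; case: (x \in E) => //=.
have [zE|zE] := boolP (z + M *m x \in E).
  rewrite (bigD1 _ zE) /= addrK eqxx big1 ?addr0 // => y /andP[_ yz].
  by rewrite subr_eq (negPf yz).
rewrite big1 // => y yE; rewrite subr_eq; case: eqP => // yz.
by rewrite -yz yE in zE.
Qed.

Lemma sum_fixed_count (M : 'M[F]_d) :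
  \sum_z (fixed_count E M z)%:R = e ^+ 2.
Proof.
under eq_bigr do rewrite fixed_countE.
rewrite exchange_big /= expr2 [RHS]mulr_natl -sumr_const.
apply: eq_bigr => x _; rewrite exchange_big /= -sumr_const.
apply: eq_bigr => y _; under eq_bigr do rewrite -[_%:R]mulr1.
exact: (sum_indicator _ (fun=> 1)).
Qed.

Lemma sum_diff_count : \sum_v diff_count v = e ^+ 2.
Proof.
rewrite exchange_big /= expr2 [RHS]mulr_natl -sumr_const.
apply: eq_bigr => x _; rewrite exchange_big /= -sumr_const.
apply: eq_bigr => y _; under eq_bigr do rewrite -[_%:R]mulr1.
exact: (sum_indicator _ (fun=> 1)).
Qed.

(** Both sides count the quadruples of E with y' - M x' = y - M x, that is, y' - y = M (x' - x). *)
Lemma sum_fixed_count_sqr (M : 'M[F]_d) :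
  \sum_z (fixed_count E M z)%:R ^+ 2
  = \sum_v diff_count v * diff_count (M *m v).
Proof.
transitivity (\sum_(x in E) \sum_(y in E) \sum_(x' in E) \sum_(y' in E)
    (y' - M *m x' == y - M *m x)%:R : R).
  under eq_bigr do rewrite expr2 {1}fixed_countE mulr_suml.
  rewrite exchange_big; apply: eq_bigr => x _ /=.
  under eq_bigr do rewrite mulr_suml.
  rewrite exchange_big; apply: eq_bigr => y _ /=.
  by rewrite sum_indicator fixed_countE.
under [RHS]eq_bigr do rewrite /diff_count mulr_suml.
rewrite [RHS]exchange_big; apply: eq_bigr => x _ /=.
under [RHS]eq_bigr do rewrite mulr_suml.
rewrite [RHS]exchange_big [LHS]exchange_big; apply: eq_bigr => x' _ /=.
rewrite sum_indicator; apply: eq_bigr => y _; apply: eq_bigr => y' _.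
congr (_ %:R); rewrite eq_sym -subr_eq0 -[in RHS]subr_eq0 mulmxBr !opprB.
by rewrite [M *m x' - y']addrC addrACA [- _ + M *m x']addrC.
Qed.

Lemma covariance (T : finType) (f g : T -> R) (s : R) :
  #|T|%:R != 0 :> R -> \sum_i f i = s -> \sum_i g i = s ->
  \sum_i (f i - s / #|T|%:R) * (g i - s / #|T|%:R)
  = \sum_i f i * g i - s ^+ 2 / #|T|%:R.
Proof.
move=> T0 fs gs; set m := s / _.
transitivity (\sum_i f i * g i - m * (\sum_i f i) - m * (\sum_i g i)
    + \sum_(i : T) m ^+ 2).
  rewrite !mulr_sumr -!sumrB -big_split /=.
  by apply: eq_bigr => i _; ring.
by rewrite fs gs sumr_const -[_ *+ _]mulr_natr /m; field.
Qed.

(** Gives the variance over translations the shape averaged in [orthogonal_average_le], with h the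
    centred [diff_count]. *)
Lemma variance_fixed_count M : M \in O ->
  \sum_z ((fixed_count E M z)%:R - mu) ^+ 2
  = \sum_v (diff_count v - mu) * (diff_count (M *m v) - mu).
Proof.
move=> MO.
have V0 : #|V|%:R != 0 :> R.
  by rewrite pnatr_eq0 -lt0n; apply/card_gt0P; exists 0.
have sM : \sum_v diff_count (M *m v) = e ^+ 2.
  by rewrite -sum_diff_count [RHS](reindex_inj (orthogonal_inj MO)).
have := covariance V0 sum_diff_count sM; rewrite -/mu => ->.
rewrite -sum_fixed_count_sqr.
have := covariance V0 (sum_fixed_count M) (sum_fixed_count M).
by rewrite -/mu => ->.
Qed.

End Variance.

End OrthogonalGroup.

(** * Variance and moments for Cartesian powers *)

Section CartesianPower.

Variables (R : realFieldType) (F : finFieldType) (D : nat) (A : {set F}).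
Hypothesis oddF : odd #|F|.

Local Notation d := D.+1.
Local Notation E := (cart_power d A).
Local Notation O := (orthogonal_group F d).
Local Notation V := 'cV[F]_d.
Local Notation q := (#|F|%:R : R).
Local Notation n := (#|A|%:R : R).
Local Notation e := (#|E|%:R : R).

Let mu : R := e ^+ 2 / #|V|%:R.

Lemma card_field_gt0 : 0 < q.
Proof. by rewrite ltr0n; apply/card_gt0P; exists 0. Qed.

Lemma mean_fixed_count_le : 0 <= mu <= e.
Proof.
have q0 := card_field_gt0.
have V0 : 0 < #|V|%:R :> R by rewrite card_cV natrX exprn_gt0.
rewrite /mu divr_ge0 ?exprn_ge0 ?ler0n //= ler_pdivrMr //.
by rewrite expr2 ler_wpM2l ?ler0n // ler_nat max_card.
Qed.

Lemma sum_sphere_deviation (t : F) :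
  \sum_(v : V | std_form v == t) (diff_count R E v - mu)
  = (dist_count E t)%:R - mu * (sphere_count d t)%:R.
Proof.
rewrite sumrB; congr (_ - _); last first.
  rewrite /sphere_count natr_sum mulr_sumr big_mkcond; apply: eq_bigr => v _ /=.
  by case: (_ == t); rewrite ?mulr1 ?mulr0.
rewrite exchange_big natr_sum /=; apply: eq_bigr => x _.
rewrite exchange_big natr_sum /=; apply: eq_bigr => y _.
rewrite big_mkcond /= -(sum_indicator (x - y) (fun v => (std_form v == t)%:R)).
by apply: eq_bigr => v _; case: (_ == t); rewrite ?mulr1 ?mulr0.
Qed.

Lemma variance_cart_power :
  \sum_(M in O) \sum_z ((fixed_count E M z)%:R - mu) ^+ 2
  <= #|O|%:R * (15 * 16 ^+ d * n * e ^+ 2).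
Proof.
have q0 := card_field_gt0; have /andP[mu0 mue] := mean_fixed_count_le.
(* K is the reciprocal of the lower bound for spheres in [card_sphere_ge]. *)
pose T : R := 16 ^+ d; pose K := T * q / q ^+ d.
have T1 : 1 <= T by rewrite exprn_ege1 // ler1n.
have q1 : 1 <= q by rewrite ler1n -(ltr0n R).
have Kq : K * q ^+ d = T * q by rewrite mulfVK // gt_eqF ?exprn_gt0.
have K0 : 0 <= K by rewrite !mulr_ge0 ?invr_ge0 ?exprn_ge0 ?ltW.
have KT : K <= T.
  rewrite -(ler_pM2r (exprn_gt0 d q0)) Kq ler_wpM2l ?(le_trans ler01) //.
  by rewrite exprS ler_peMr ?exprn_ege1 // ltW.
rewrite (eq_bigr _ (fun M MO => variance_fixed_count oddF R E MO)) -/mu.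
have hK (v : V) : v != 0 -> 1 <= K * #|sphere d (std_form v)|%:R.
  move=> /(card_sphere_ge oddF); rewrite -(ler_nat R) !natrM !natrX => hq.
  by rewrite -(ler_pM2r (exprn_gt0 d q0)) mul1r mulrAC Kq.
apply: le_trans (orthogonal_average_le oddF _ K0 hK) _.
rewrite ler_wpM2l ?ler0n //.
have h0 : (diff_count R E 0 - mu) ^+ 2 <= e ^+ 2.
  have -> : diff_count R E 0 = e.
    rewrite /diff_count -sumr_const; apply: eq_bigr => x xE.
    rewrite (bigD1 x xE) /= subrr eqxx big1 ?addr0 // => y /andP[_ yx].
    by rewrite subr_eq0 eq_sym (negPf yx).
  by rewrite lerXn2r ?nnegrE ?subr_ge0 // gerBl.
have dev : q * q ^+ d ^+ 2 *
    (\sum_t (\sum_(v : V | std_form v == t) (diff_count R E v - mu)) ^+ 2)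
   <= 6 * n * e ^+ 2 * q ^+ d ^+ 3.
  have := dist_count_deviation R D A oddF; rewrite card_cart_power natrX.
  move=> dev; apply: (le_trans _ dev); rewrite le_eqVlt; apply/orP; left; apply/eqP.
  rewrite -mulrA mulr_sumr; congr (_ * _); apply: eq_bigr => t _.
  rewrite sum_sphere_deviation /mu -exprMn mulrBr !mulrA; congr ((_ - _ * _) ^+ 2).
  rewrite card_cV natrX card_cart_power natrX.
  by field; rewrite gt_eqF ?exprn_gt0.
move: dev h0; set S := \sum_t _ ^+ 2; set h := (_ - mu) ^+ 2 => dev h0.
have S0 : 0 <= S by apply: sumr_ge0 => t _; rewrite sqr_ge0.
have KS : K * S <= 6 * T * (n * e ^+ 2).
  have qd0 := exprn_gt0 d q0.
  rewrite -(ler_pM2r (exprn_gt0 2 qd0)) -(ler_pM2r q0) -(ler_pM2r qd0).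
  have -> : K * S * q ^+ d ^+ 2 * q * q ^+ d = T * q * (q * q ^+ d ^+ 2 * S).
    by rewrite -Kq; ring.
  have -> : 6 * T * (n * e ^+ 2) * q ^+ d ^+ 2 * q * q ^+ d
      = T * q * (6 * n * e ^+ 2 * q ^+ d ^+ 3) by ring.
  by rewrite ler_wpM2l // mulr_ge0 ?ltW // (lt_le_trans ltr01).
have hne : h <= n * e ^+ 2.
  apply: (le_trans h0); have [n0|n0] := posnP #|A|.
    by rewrite card_cart_power n0 exp0n // expr0n mulr0.
  by rewrite ler_peMl ?sqr_ge0 // ler1n.
have Kh : (1 + 2 * K) * h <= (1 + 2 * T) * (n * e ^+ 2).
  by apply: ler_pM; rewrite ?sqr_ge0 //; lra.
(* 15 = 3 + 12: 1 + 2T is at most 3T, and 2 K S is at most 12 T n e^2. *)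
have : 0 <= n * e ^+ 2 by rewrite mulr_ge0 ?ler0n ?sqr_ge0.
rewrite -/T; nra.
Qed.

(** The exponent is the number of vertices of a (k+1)-simplex: two factors go to the variance, the
    other k are bounded by e. *)
Lemma fixed_count_pow_le (k : nat) (M : 'M[F]_d) (z : V) :
  (fixed_count E M z)%:R ^+ k.+2
  <= (2 * mu) ^+ k.+2 + 4 * e ^+ k * ((fixed_count E M z)%:R - mu) ^+ 2.
Proof.
have /andP[mu0 _] := mean_fixed_count_le; set l := _%:R.
have l0 : 0 <= l by rewrite ler0n.
have m0 : 0 <= 2 * mu by lra.
have le : l <= e.
  by rewrite ler_nat; apply/subset_leq_card/subsetP => x; rewrite inE => /andP[].
(* If l > 2 mu then l < 2 (l - mu), whence the factor 4. *)
have [lm|ml] := lerP l (2 * mu).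
  apply: ler_wpDr; first by rewrite mulr_ge0 ?sqr_ge0 // mulr_ge0 ?exprn_ge0 ?ler0n.
  by rewrite lerXn2r ?nnegrE.
apply: ler_wpDl; first by rewrite exprn_ge0.
rewrite -addn2 exprD mulrAC mulrC ler_pM ?sqr_ge0 ?exprn_ge0 //.
  nra.
by rewrite lerXn2r ?nnegrE ?ler0n.
Qed.

(** The hypothesis makes the variance term comparable with the main term, in which q^d [mu] = e^2.
    The constant 60 is 4 times 15. *)
Lemma moment_fixed_count (k : nat) (c : R) :
  q ^+ (d * k.+1) * n <= c * e ^+ k.+2 ->
  q ^+ (d * k.+1) * (\sum_(M in O) \sum_z (fixed_count E M z)%:R ^+ k.+2)
  <= #|O|%:R * ((2 ^+ k.+2 + 60 * 16 ^+ d * c) * e ^+ (2 * k.+2)).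
Proof.
have q0 := card_field_gt0; have qd0 := exprn_gt0 d q0 => hc.
have h1 : \sum_(M in O) \sum_z (fixed_count E M z)%:R ^+ k.+2
   <= #|O|%:R * (q ^+ d * (2 * mu) ^+ k.+2)
     + 4 * e ^+ k * (#|O|%:R * (15 * 16 ^+ d * n * e ^+ 2)).
  apply: (@le_trans _ _ (\sum_(M in O) \sum_z
     ((2 * mu) ^+ k.+2 + 4 * e ^+ k * ((fixed_count E M z)%:R - mu) ^+ 2))).
    by do 2![apply: ler_sum => ? _]; apply: fixed_count_pow_le.
  under eq_bigr do rewrite big_split /= sumr_const -mulr_sumr.
  rewrite big_split /= sumr_const -mulr_sumr; apply: lerD.
    by rewrite card_cV -[X in X <= _]mulr_natl -[(2 * mu) ^+ _ *+ _]mulr_natl natrX.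
  rewrite ler_wpM2l ?variance_cart_power //.
  by rewrite mulr_ge0 ?exprn_ge0 ?ler0n.
apply: le_trans (ler_wpM2l _ h1) _; first by rewrite exprn_ge0 ?ltW.
have -> : q ^+ (d * k.+1) * (#|O|%:R * (q ^+ d * (2 * mu) ^+ k.+2) +
     4 * e ^+ k * (#|O|%:R * (15 * 16 ^+ d * n * e ^+ 2)))
   = #|O|%:R * (2 ^+ k.+2 * (q ^+ d * mu) ^+ k.+2
       + 60 * 16 ^+ d * e ^+ k.+2 * (q ^+ (d * k.+1) * n)).
  rewrite !exprMn -[(q ^+ d) ^+ k.+2]exprM [(d * k.+2)%N]mulnS exprD.
  have -> : e ^+ k.+2 = e ^+ k * e ^+ 2 by rewrite -addn2 exprD.
  by ring.
have -> : q ^+ d * mu = e ^+ 2.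
  by rewrite /mu card_cV natrX mulrC divfK // gt_eqF.
rewrite ler_wpM2l ?ler0n // [(_ + _) * e ^+ _]mulrDl -exprM lerD2l.
have -> : 60 * 16 ^+ d * c * e ^+ (2 * k.+2)
    = 60 * 16 ^+ d * e ^+ k.+2 * (c * e ^+ k.+2).
  by rewrite mul2n -addnn exprD; ring.
by rewrite ler_wpM2l // mulr_ge0 ?exprn_ge0 ?ler0n // mulr_ge0 ?exprn_ge0 ?ler0n.
Qed.

End CartesianPower.

(** * Orbits of tuples of vectors *)

(** The exponent d j - C(j+1, 2) of the orbit bound is nondecreasing for j up to d: its increment
    from j to j + 1 is d - (j + 1). Stated without subtraction. *)
Lemma leq_bin2_mul (j k d : nat) : (j <= k)%N -> (k <= d)%N ->
  ('C(k.+1, 2) + d * j <= d * k + 'C(j.+1, 2))%N.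
Proof.
elim: k => [|k IH]; first by rewrite leqn0 => /eqP ->; rewrite addnC.
rewrite leq_eqVlt => /orP[/eqP -> _|jk kd]; first by rewrite addnC.
rewrite binS bin1 mulnS; have := IH jk (ltnW kd).
by move: 'C(k.+1, 2) 'C(j.+1, 2) (d * j)%N (d * k)%N => *; lia.
Qed.

Section Orbits.

Variables (F : finFieldType) (d : nat).
Hypothesis oddF : odd #|F|.

Local Notation O := (orthogonal_group F d).

(* Tuples of vectors are the rows of a matrix. *)
Definition orbit_mx (k : nat) (X : 'M[F]_(k, d)) : {set 'M[F]_(k, d)} :=
  [set X *m M^T | M : 'M[F]_d in O].

(** Counts the images of a row y0 once those of the rows of X are fixed. The inner products with X
    confine y to y0 + W, with W of codimension the rank of X; the norm condition cuts out a quadric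
    there. *)
Lemma card_fiber_le (k : nat) (X : 'M[F]_(k, d)) (y0 : 'rV[F]_d) :
  ~~ (y0 <= X)%MS ->
  (#|[set y : 'rV[F]_d | (y *m X^T == y0 *m X^T) && (y *m y^T == y0 *m y0^T)]|
    * #|F| ^ (\rank X).+1 <= 4 * #|F| ^ d)%N.
Proof.
move=> y0X; set Y := [set _ | _].
pose W := rowg (kermx X^T).
have WE (w : 'rV[F]_d) : (w \in W) = (w *m X^T == 0) by rewrite inE sub_kermx.
have cW : (#|W| * #|F| ^ \rank X = #|F| ^ d)%N.
  by rewrite card_rowg mxrank_ker mxrank_tr -expnD subnK // rank_leq_col.
pose phi (w : 'rV[F]_d) : F := 2 * (y0 *m w^T) 0 0 + (w *m w^T) 0 0.
have tr_dot (u w : 'rV[F]_d) : (w *m u^T) 0 0 = (u *m w^T) 0 0.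
  transitivity ((w *m u^T)^T 0 0); first by rewrite [RHS]mxE.
  by rewrite trmx_mul trmxK.
have addE (B C : 'M[F]_1) : (B + C) 0 0 = B 0 0 + C 0 0 by rewrite mxE.
have oppE (B : 'M[F]_1) : (- B) 0 0 = - B 0 0 by rewrite mxE.
have scaleE s (B : 'M[F]_1) : (s *: B) 0 0 = s * B 0 0 by rewrite mxE.
have phiE w : phi w = ((y0 + w) *m (y0 + w)^T) 0 0 - (y0 *m y0^T) 0 0.
  rewrite /phi [(_ + w)^T]linearD mulmxDl !mulmxDr !addE.
  by rewrite (tr_dot y0 w); ring.
have phiN w : phi (- w) = phi w - 4 * (y0 *m w^T) 0 0.
  by rewrite /phi [(- w)^T]linearN mulmxN mulNmx mulmxN opprK oppE; ring.
(* Otherwise y0 would be orthogonal to W, that is, in the row space of X. *)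
have [w0 w0W phi0] : exists2 w, w \in W & phi w != 0.
  have [|i [j]] := @mx_neq0 _ _ _ (y0 *m cokermx X); first by rewrite -submxE.
  rewrite ord1 => yj.
  pose w := (col j (cokermx X))^T.
  have wW : w \in W.
    by rewrite WE -trmx_mul colE mulmxA mulmx_coker mul0mx trmx0.
  have yw : (y0 *m w^T) 0 0 != 0 by rewrite trmxK colE mulmxA -colE mxE.
  (* [phi w] and [phi (- w)] differ by four times the nonzero product of y0 and w, so they do not
     both vanish. *)
  have [e|] := eqVneq (phi w) 0; last by exists w.
  exists (- w); first by rewrite WE mulNmx oppr_eq0 -WE.
  rewrite phiN e sub0r oppr_eq0 mulf_neq0 // (_ : 4 = 2 * 2); last by ring.
  by rewrite mulf_neq0 // two_neq0.
have YZ : Y = [set y0 + w | w in [set w in W | phi w == 0]].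
  apply/setP => y; rewrite inE; apply/andP/imsetP => [[/eqP e1 /eqP e2]|[w]].
    exists (y - y0); last by rewrite addrC subrK.
    by rewrite inE WE mulmxBl e1 subrr eqxx phiE [y0 + _]addrC subrK e2 subrr eqxx.
  rewrite inE WE phiE => /andP[/eqP wX]; rewrite subr_eq0 => /eqP e -> {y}.
  rewrite mulmxDl wX addr0 eqxx; split=> //; apply/eqP/matrixP => i j.
  by rewrite !ord1.
rewrite YZ card_imset; last exact: addrI.
rewrite expnSr mulnA mulnAC.
have : (#|[set w in W | phi w == 0%R]| * #|F| <= 4 * #|W|)%N.
  apply: card_quadric w0W phi0 => [w u|x y xW yW s].
    exists (2 * (y0 *m u^T) 0 0 + 2 * (w *m u^T) 0 0), ((u *m u^T) 0 0) => s.
    rewrite /phi [(w + _)^T]linearD /= [(s *: u)^T]linearZ /= mulmxDl !mulmxDr.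
    rewrite -!scalemxAl -!scalemxAr !addE !scaleE.
    by rewrite (tr_dot w u); ring.
  move: xW yW; rewrite !WE -scalemxAl mulmxBl => /eqP -> /eqP ->; by rewrite subrr scaler0.
by rewrite -cW mulnA leq_mul2r => ->; rewrite orbT.
Qed.

Lemma orbit_mxP (k : nat) (X Y : 'M[F]_(k, d)) :
  reflect (exists2 M, M \in O & Y = X *m M^T) (Y \in orbit_mx X).
Proof. exact: imsetP. Qed.

(** Induction on the rows. A first row dependent on the others has its image determined by theirs;
    an independent one has at most 4 q^(d - r - 1) images, r being the rank of the others. *)
Lemma card_orbit_rank_le (k : nat) (X : 'M[F]_(k, d)) :
  (#|orbit_mx X| * #|F| ^ 'C((\rank X).+1, 2) <= 4 ^ k * #|F| ^ (d * \rank X))%N.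
Proof.
elim: k X => [|k IH] X.
  rewrite (_ : \rank X = 0)%N; last by apply/eqP; rewrite -leqn0 rank_leq_row.
  rewrite muln0 bin_small // !muln1.
  apply: (@leq_trans #|[set (0 : 'M[F]_(0, d))]|); last by rewrite cards1.
  apply: subset_leq_card.
  by apply/subsetP => Y _; rewrite inE [Y]flatmx0.
pose x : 'rV_d := usubmx (X : 'M_(1 + k, d)).
pose X' : 'M_(k, d) := dsubmx (X : 'M_(1 + k, d)).
have XE : X = col_mx x X' :> 'M_(1 + k, d) by rewrite vsubmxK.
pose down (Y : 'M[F]_(k.+1, d)) := dsubmx (Y : 'M_(1 + k, d)).
pose up (Y : 'M[F]_(k.+1, d)) := usubmx (Y : 'M_(1 + k, d)).
have sXE : (x + X' :=: X)%MS.
  by have := addsmxE x X'; rewrite -XE.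
have upM M : up (X *m M) = x *m M by exact: esym (@mul_usub_mx _ 1 k d d _ _).
have downM M : down (X *m M) = X' *m M by exact: esym (@mul_dsub_mx _ 1 k d d _ _).
have up_inj Y Z : down Y = down Z -> up Y = up Z -> Y = Z.
  move=> h1 h2; rewrite -[Y](@vsubmxK _ 1 k d) -[Z](@vsubmxK _ 1 k d).
  by rewrite -/(up Y) h2 -/(down Y) h1.
have fibers b : (forall Y', (#|[set Y in orbit_mx X | down Y == Y']| <= b)%N) ->
    (#|orbit_mx X| <= #|orbit_mx X'| * b)%N.
  move=> hb; rewrite -sum1_card (partition_big down [in orbit_mx X']) /=.
    rewrite -sum_nat_const; apply: leq_sum => Y' _; rewrite sum1_card.
    by apply: leq_trans (hb Y'); rewrite cardsE.
  by move=> _ /orbit_mxP[M MO ->]; rewrite downM; apply/orbit_mxP; exists M.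
have [xX'|xX'] := boolP (x <= X')%MS.
  have rX : \rank X = \rank X'.
    by rewrite -sXE (addsmx_idPr xX').
  have cX : (#|orbit_mx X| <= #|orbit_mx X'|)%N.
    rewrite -[leqRHS]muln1; apply: fibers => Y'.
    apply/card_le1_eqP => Y Z; rewrite !inE.
    move=> /andP[/orbit_mxP[M _ ->] /eqP MY] /andP[/orbit_mxP[N _ ->] /eqP NY].
    apply: up_inj; first by rewrite MY NY.
    move: MY NY; rewrite !upM !downM -[x](mulmxKpV xX') -!mulmxA => -> ->.
    by [].
  rewrite rX; apply: leq_trans (leq_mul cX (leqnn _)) _.
  by apply: leq_trans (IH X') _; rewrite leq_mul2r leq_exp2l // leqnSn orbT.
have rX : \rank X = (\rank X').+1.
  apply/eqP; rewrite eqn_leq; apply/andP; split.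
    rewrite -sXE -[X in (_ <= X)%N]add1n.
    by apply: leq_trans (mxrank_adds_leqif _ _) _; rewrite leq_add2r rank_leq_row.
  apply: rank_ltmx; rewrite /ltmx -!sXE addsmxSr /=.
  by apply: contra xX' => h; apply: submx_trans (addsmxSl _ _) h.
have qX : (#|F| ^ (\rank X').+1 > 0)%N.
  by rewrite expn_gt0; apply/orP; left; apply/card_gt0P; exists 0.
have fib : (#|orbit_mx X| <= #|orbit_mx X'| * (4 * #|F| ^ d %/ #|F| ^ (\rank X').+1))%N.
  apply: fibers => Y'; rewrite leq_divRL //.
  have [->|[Y0]] := set_0Vmem [set Y in orbit_mx X | down Y == Y'].
    by rewrite cards0.
  rewrite inE => /andP[/orbit_mxP[M0 M0O ->]]; rewrite downM => /eqP Y'E.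
  have M0u : M0^T \in unitmx by have := orthogonal_tr oddF M0O; rewrite inE => /andP[].
  have y0Y : ~~ (x *m M0^T <= Y')%MS.
    by apply: contra xX'; rewrite -Y'E submxMfree // row_free_unit.
  have rY : \rank Y' = \rank X' by rewrite -Y'E mxrankMfree // row_free_unit.
  (* Inner products are preserved, so all first rows over Y' satisfy the conditions of
     [card_fiber_le]. *)
  have inner m (B : 'M_(m, d)) N : N \in O -> x *m N^T *m (B *m N^T)^T = x *m B^T.
    move=> /(orthogonal_groupP oddF) NN.
    by rewrite trmx_mul trmxK -mulmxA (mulmxA N^T) NN mul1mx.
  rewrite -rY; apply: leq_trans (card_fiber_le y0Y); rewrite leq_mul2r; apply/orP; right.
  rewrite -(card_in_imset (f := up)) => [|Y Z]; last first.
    rewrite !inE => /andP[_ /eqP dY] /andP[_ /eqP dZ]; apply: up_inj.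
    by rewrite dY dZ.
  apply: subset_leq_card; apply/subsetP => y /imsetP[Y].
  rewrite !inE => /andP[/orbit_mxP[M MO ->]]; rewrite downM upM => /eqP YM ->.
  by rewrite (inner _ x) // (inner _ x) // -{1}YM -Y'E !inner // !eqxx.
have := leq_mul (IH X') (leq_divM (4 * #|F| ^ d) (#|F| ^ (\rank X').+1)).
have -> : (4 ^ k * #|F| ^ (d * \rank X') * (4 * #|F| ^ d)
    = 4 ^ k.+1 * #|F| ^ (d * \rank X))%N.
  by rewrite rX mulnS expnD expnS mulnACA mulnC [(4 ^ k * 4)%N]mulnC mulnC
    [(#|F| ^ (d * _) * _)%N]mulnC.
apply: leq_trans; rewrite mulnACA rX binS bin1 expnD leq_mul2r fib orbT //.
Qed.

(** By monotonicity of the exponent, degenerate tuples obey the bound for full rank. *)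
Lemma card_orbit_le (k : nat) (X : 'M[F]_(k, d)) : (k <= d)%N ->
  (#|orbit_mx X| * #|F| ^ 'C(k.+1, 2) <= 4 ^ k * #|F| ^ (d * k))%N.
Proof.
move=> kd; have F0 : (0 < #|F|)%N by apply/card_gt0P; exists 0.
have := leq_bin2_mul (rank_leq_row X) kd; set j := \rank X => mono.
rewrite -(leq_pmul2r (_ : 0 < #|F| ^ 'C(j.+1, 2))%N) ?expn_gt0 ?F0 //.
rewrite mulnAC.
apply: leq_trans (leq_mul (card_orbit_rank_le X) (leqnn _)) _.
rewrite -!mulnA leq_mul2l -!expnD addnC.
by rewrite leq_pexp2l ?orbT.
Qed.

(** Orbit-stabilizer: left multiplication by M0 N^T injects the fibre over X N^T into the fibre over
    Y = X M0^T. *)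
Lemma card_orthogonal_eq (k : nat) (X Y : 'M[F]_(k, d)) : Y \in orbit_mx X ->
  (#|O| <= #|orbit_mx X| * #|[set M in O | X *m M^T == Y]|)%N.
Proof.
move=> /orbit_mxP[M0 M0O ->].
rewrite -[leqLHS]sum1_card.
rewrite (partition_big (fun M : 'M[F]_d => X *m M^T) [in orbit_mx X]) /=.
  rewrite -sum_nat_const; apply: leq_sum => Z /orbit_mxP[N NO ->].
  rewrite sum1_card.
  have /(orthogonal_groupP oddF) NN := NO.
  have PO := orthogonalM oddF M0O (orthogonal_tr oddF NO).
  have P_inj := @orthogonal_inj F d oddF d _ PO.
  rewrite -(card_imset _ P_inj); apply: subset_leq_card.
  apply/subsetP => B /imsetP[M]; rewrite unfold_in => /andP[MO /eqP XM] ->.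
  rewrite inE orthogonalM //=; apply/eqP.
  by rewrite !trmx_mul trmxK !mulmxA XM -(mulmxA X) NN mulmx1.
by move=> M MO; apply/orbit_mxP; exists M.
Qed.

End Orbits.

(** * Congruence classes of simplices *)

Section CongruenceClasses.

Variables (F : finFieldType) (d k : nat) (E : {set 'cV[F]_d}).
Hypotheses (oddF : odd #|F|) (kd : (k <= d)%N).

Local Notation O := (orthogonal_group F d).
Local Notation V := 'cV[F]_d.
Local Notation S := (simplices_in k E).
Local Notation cl := (@congruence_class F d k).

(** Edges from vertex 0 remove the translation; an isometry acts on them by right multiplication by
    [M^T]. *)
Definition edge_mx (x : simplex F d k) : 'M[F]_(k, d) :=
  \matrix_i (x (lift ord0 i) - x ord0)^T.

Definition isometries (x y : simplex F d k) : {set 'M[F]_d * V} :=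
  [set p | (p.1 \in O) && [forall i, p.2 + p.1 *m x i == y i]].

Lemma row_edge_mx x i : row i (edge_mx x) = (x (lift ord0 i) - x ord0)^T.
Proof. by rewrite rowK. Qed.

(** Vertex 0 forces the translation, so every M matching the edge matrices gives an isometry;
    orbit-stabilizer and the orbit bound count these M. *)
Lemma card_isometries_ge x y : congruent x y ->
  (#|O| * #|F| ^ 'C(k.+1, 2) <= 4 ^ k * #|F| ^ (d * k) * #|isometries x y|)%N.
Proof.
move=> /exists_inP[M MO /existsP[z /forallP zM]].
have xy i : M *m x i = y i - z by rewrite -(eqP (zM i)) addrC addKr.
have XY : edge_mx y = edge_mx x *m M^T.
  apply/row_matrixP => i; rewrite row_mul !row_edge_mx -trmx_mul mulmxBr !xy.
  by rewrite opprB addrA subrK.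
have Yorb : edge_mx y \in orbit_mx (edge_mx x) by apply/orbit_mxP; exists M.
have := card_orthogonal_eq oddF Yorb; set T := [set _ in _ | _] => hO.
apply: leq_trans (leq_mul hO (leqnn _)) _.
rewrite mulnAC; apply: leq_mul; first exact: card_orbit_le.
pose f (N : 'M[F]_d) := (N, y ord0 - N *m x ord0).
rewrite -(card_imset (f := f)) => [|N N' []] //.
apply: subset_leq_card; apply/subsetP => p /imsetP[N].
rewrite !inE => /andP[NO /eqP NX] -> /=.
apply/andP; split=> //; apply/forallP => i.
have [j ->|->] := unliftP ord0 i; last by rewrite subrK.
rewrite addrAC -addrA -mulmxBr.
have /(congr1 (row j)) := NX; rewrite row_mul !row_edge_mx -trmx_mul.
by move/trmx_inj => ->; rewrite addrC subrK.
Qed.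

Lemma card_simplices_in : #|S| = (#|E| ^ k.+1)%N.
Proof.
rewrite -[k.+1 in RHS]card_ord -card_ffun_on -cardsE; apply: eq_card => x.
by rewrite !inE; apply/forallP/ffun_onP.
Qed.

(** For a fixed motion g, x determines y = g x, and every vertex of x lies in E :&: g^-1 E. *)
Lemma sum_isometries_le :
  (\sum_(x in S) \sum_(y in S) #|isometries x y|
   <= \sum_(M in O) \sum_z fixed_count E M z ^ k.+1)%N.
Proof.
have E1 x y : #|isometries x y|
    = (\sum_(M in O) \sum_(z : V) [forall i, (z + M *m x i == y i)%R])%N.
  rewrite -sum1_card pair_big /= [LHS]big_mkcond [RHS]big_mkcond.
  apply: eq_bigr => p _; rewrite inE /= andbT; by case: (_ \in O); case: [forall i, _].
under eq_bigr do under eq_bigr do rewrite E1.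
under eq_bigr do rewrite exchange_big.
rewrite exchange_big; apply: leq_sum => M MO /=.
under eq_bigr do rewrite exchange_big.
rewrite exchange_big; apply: leq_sum => z _ /=.
pose G := [set x in E | z + M *m x \in E].
have -> : (fixed_count E M z ^ k.+1
    = #|(ffun_on (mem G) : {pred {ffun 'I_k.+1 -> V}})|)%N.
  by rewrite card_ffun_on card_ord.
rewrite -sum1_card [leqRHS]big_mkcond /=.
rewrite [leqLHS]big_mkcond; apply: leq_sum => x _ /=.
case: ifP => // xS.
have [xE|nE] := boolP (x \in ffun_on (mem G)).
  pose y0 : simplex F d k := [ffun i => z + M *m x i].
  apply: (@leq_trans (\sum_(y in S) (y == y0))).
    apply: leq_sum => y _; case: (boolP [forall i, _]) => // /forallP h.
    suff -> : y = y0 by rewrite eqxx.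
    by apply/ffunP => i; rewrite ffunE; apply/esym/eqP.
  rewrite -big_mkcondr sum1_card; apply: leq_trans (eq_leq (cards1 y0)).
  by apply: subset_leq_card; apply/subsetP => y; rewrite inE => /andP[].
rewrite big1 // => y; rewrite inE => /forallP yE.
case: (boolP [forall i, _]) => // /forallP h; case/ffun_onP: nE => i.
by move: xS; rewrite !inE => /forallP ->; rewrite (eqP (h i)) yE.
Qed.

Lemma congruence_class_refl x : x \in cl x.
Proof.
rewrite inE; apply/exists_inP; exists 1%:M; first exact: orthogonal1.
by apply/existsP; exists 0; apply/forallP => i; rewrite mul1mx add0r.
Qed.

(** Cauchy-Schwarz over the determined classes, applied to the number of simplices of E in each. *)
Lemma sqr_card_simplices_le :
  ((#|E| ^ k.+1) ^ 2
   <= #|determined_classes k E| * \sum_(x in S) \sum_(y in S) (cl x == cl y))%N.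
Proof.
have sumS (f : {set simplex F d k} -> nat) :
    (\sum_(x in S) f (cl x)
     = \sum_(c in determined_classes k E) #|[set x in S | cl x == c]| * f c)%N.
  rewrite (partition_big cl [in determined_classes k E]) /=.
    apply: eq_bigr => c _; rewrite -sum1_card big_distrl /=.
    by apply: eq_big => [x|x /andP[_ /eqP ->]]; rewrite ?inE ?mul1n.
  by move=> x xS; apply: imset_f.
rewrite -card_simplices_in -sum1_card (sumS (fun=> 1%N)).
under eq_bigr do rewrite muln1.
have -> : (\sum_(x in S) \sum_(y in S) (cl x == cl y)
    = \sum_(c in determined_classes k E) #|[set x in S | cl x == c]| ^ 2)%N.
  rewrite (sumS (fun c => \sum_(y in S) (c == cl y))%N).
  apply: eq_bigr => c _; rewrite expnS expn1; congr (_ * _)%N.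
  rewrite -sum1_card [RHS]big_mkcond [LHS]big_mkcond; apply: eq_bigr => x _.
  by rewrite inE eq_sym; case: (x \in S).
rewrite -(ler_nat algC) natrM natrX !natr_sum.
under [X in _ <= _ * X]eq_bigr do rewrite natrX.
by apply: sqr_sum_le_card => c; apply: realn.
Qed.

(** Each congruent pair is weighted by its isometries, whose number is bounded below by
    [card_isometries_ge]; denominators are cleared. *)
Lemma card_determined_classes_ge :
  (#|E| ^ (2 * k.+1) * (#|O| * #|F| ^ 'C(k.+1, 2))
   <= #|determined_classes k E| * (4 ^ k * #|F| ^ (d * k)
      * \sum_(M in O) \sum_z fixed_count E M z ^ k.+1))%N.
Proof.
rewrite mulnC [(2 * _)%N]mulnC expnM mulnC.
apply: leq_trans (leq_mul sqr_card_simplices_le (leqnn _)) _.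
rewrite -mulnA leq_mul2l; apply/orP; right.
apply: leq_trans (leq_mul (leqnn _) sum_isometries_le).
rewrite big_distrl big_distrr; apply: leq_sum => x _ /=.
rewrite big_distrl big_distrr; apply: leq_sum => y _ /=.
have [e|_] := eqVneq (cl x) (cl y); last by rewrite mul0n.
rewrite mul1n; apply: card_isometries_ge.
by have := congruence_class_refl y; rewrite -e inE.
Qed.

End CongruenceClasses.

(** * The size hypothesis and the final count *)

(** Raising the hypothesis to the power a = k + 1 - 1/d turns the exponent of q into kd; multiplying
    by n then makes n^(da) into n^(d(k+1)), as da + 1 = d(k + 1). *)
Lemma size_hypothesis_pow (R : realType) (k d : nat) (C q n : R) :
  (0 < k)%N -> (0 < d)%N -> 0 < C -> 0 < q -> 0 <= n ->
  C * q `^ ((k * d)%:R / (k%:R + 1 - 1 / d%:R)) <= n ^+ d ->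
  q ^+ (d * k) * n <= (C `^ (k%:R + 1 - 1 / d%:R))^-1 * (n ^+ d) ^+ k.+1.
Proof.
move=> k0 d0 C0 q0 n0 hC; set a : R := k%:R + 1 - 1 / d%:R in hC *.
have dR : (d%:R : R) != 0 by rewrite pnatr_eq0 -lt0n.
have a_gt0 : 0 < a.
  rewrite /a -addrA ltr_wpDr ?ltr0n // subr_ge0 ler_pdivrMr ?ltr0n //.
  by rewrite mul1r ler1n.
have e0 : 0 < n ^+ d by apply: lt_le_trans hC; rewrite mulr_gt0 ?powR_gt0.
have n_gt0 : 0 < n.
  by rewrite lt0r n0 andbT; apply: contraTneq e0 => ->; rewrite expr0n gtn_eqF ?ltxx.
have Ca0 : 0 < C `^ a by rewrite powR_gt0.
rewrite ler_pdivlMl // mulrA.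
have -> : C `^ a * q ^+ (d * k) = (C * q `^ ((k * d)%:R / a)) `^ a.
  rewrite powRM ?powR_ge0 ?ltW // -powRrM divfK ?gt_eqF //.
  by rewrite powR_mulrn ?ltW // mulnC.
have -> : (n ^+ d) ^+ k.+1 = (n ^+ d) `^ a * n.
  rewrite -exprM -!powR_mulrn // -powRrM -[X in _ * X]powRr1 //.
  rewrite -powRD; last by rewrite (gt_eqF n_gt0) implybT.
  by congr (_ `^ _); rewrite natrM /a -natr1; field.
rewrite ler_wpM2r //; apply: ge0_ler_powR hC; rewrite ?nnegrE ?(ltW e0) ?ltW //.
by rewrite mulr_gt0 ?powR_gt0.
Qed.

Theorem corollary1p3 (R : realType) (k d : nat) (hk : (1 <= k)%N)
    (hkd : (k <= d)%N) (C : R) (hC : 0 < C) :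
  exists2 c : R, 0 < c &
    forall (F : finFieldType) (A : {set F}),
      odd #|F| ->
      C * #|F|%:R `^ ((k * d)%:R / (k%:R + 1 - 1 / d%:R))
        <= #|cart_power d A|%:R ->
      c * #|F|%:R ^+ 'C(k.+1, 2)
        <= #|determined_classes k (cart_power d A)|%:R.
Proof.
have d0 : (0 < d)%N := leq_trans hk hkd.
(* [c0] comes from the size hypothesis. In [c1], 4^k comes from the orbit bound, 2^(k+1) from the
   main term of the moment and the rest from the variance. *)
pose c0 : R := (C `^ (k%:R + 1 - 1 / d%:R))^-1.
pose c1 : R := 4 ^+ k * (2 ^+ k.+1 + 60 * 16 ^+ d * c0).
have c0_gt0 : 0 < c0 by rewrite invr_gt0 powR_gt0.
have c1_gt0 : 0 < c1.
  by rewrite mulr_gt0 ?exprn_gt0 // addr_gt0 ?exprn_gt0 // !mulr_gt0 // exprn_gt0.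
exists c1^-1; first by rewrite invr_gt0.
move=> F A oddF hE.
have q0 := card_field_gt0 R F.
have e0 : 0 < #|cart_power d A|%:R :> R.
  by apply: lt_le_trans hE; rewrite mulr_gt0 ?powR_gt0.
have O0 : 0 < #|orthogonal_group F d|%:R :> R.
  by rewrite ltr0n; apply/card_gt0P; exists 1%:M; apply: orthogonal1.
have size_ge : #|F|%:R ^+ (d * k) * #|A|%:R <= c0 * #|cart_power d A|%:R ^+ k.+1.
  move: hE; rewrite card_cart_power natrX.
  exact: size_hypothesis_pow.
have := card_determined_classes_ge (cart_power d A) oddF hkd.
rewrite -(ler_nat R) !natrM !natrX natr_sum.
under eq_bigr do rewrite natr_sum; under eq_bigr do under eq_bigr do rewrite natrX.
case: k hk hkd @c0 @c1 c0_gt0 c1_gt0 hE size_ge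
  => // k _ hkd c0 c1 c0_gt0 c1_gt0 hE size_ge.
case: d d0 hkd @c0 @c1 c0_gt0 c1_gt0 hE size_ge e0 O0
  => // d _ hkd c0 c1 c0_gt0 c1_gt0 hE size_ge e0 O0.
have := moment_fixed_count oddF size_ge.
set L := \sum_(M in _) _ => hL hN.
set e : R := _%:R in e0 size_ge hL hN; set o : R := _%:R in O0 hL hN.
(* This positive factor occurs in both the lower bound for the classes and the moment bound, and
   cancels. *)
have eo0 : 0 < e ^+ (2 * k.+2) * o by rewrite mulr_gt0 ?exprn_gt0.
rewrite ler_pdivrMl // -(ler_pM2l eo0) -mulrA.
apply: (le_trans hN); set N := _%:R.
have -> : e ^+ (2 * k.+2) * o * (c1 * N)
   = N * (4 ^+ k.+1 * (o * ((2 ^+ k.+2 + 60 * 16 ^+ d.+1 * c0) * e ^+ (2 * k.+2)))).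
  by rewrite /c1; ring.
by rewrite ler_wpM2l ?ler0n // -mulrA ler_wpM2l ?exprn_ge0.
Qed.
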